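(* Let $q\ge1$, assume that $m_{\Delta,q}\neq0$, and let \[ \beta_q=\mathsf K_q^{\dagger}m_{\Delta,q}=\mathsf K_q^{\dagger/2}\widetilde m_{\Delta,q} \] denote the truncated Fisher discriminant. Then $\beta_q$ is an eigenfunction of the induced coordinatewise operator $\widetilde{\mathsf K}_{4,q}$ if and only if there exists a constant $c>0$ such that $\widetilde\nu_j^{\,2}=c$ for every $j\in\{1,\dots,q\}$ with $\widetilde\nu_j\neq0$. In that case, \[ \widetilde{\mathsf K}_{4,q}\beta_q=\kappa_{\Delta,q}\beta_q,\qquad \kappa_{\Delta,q}=3+2\rho c+\rho(1-3\rho)c^2. \] In particular, the condition is automatically satisfied whenever $\widetilde m_{\Delta,q}$ is supported on a single Karhunen--Loève direction, i.e. $\widetilde m_{\Delta,q}=\widetilde\nu_{j_*}\gamma_{j_*}$ for some $j_*\in\{1,\dots,q\}$.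
   Context: Let $H=L^2([0,1])$ (real) with its usual inner product. For $f,g\in H$, $f\otimes g$ is the rank-one operator $(f\otimes g)(h)=\langle h,g\rangle f$. Let $X_\ell\sim\mathbb G(m_\ell,\mathsf K)$, $\ell=1,2$, be Gaussian random elements of $H$ with means $m_1,m_2\in H$ and common covariance operator $\mathsf K$ induced by a continuous covariance kernel; $\mathsf K$ is self-adjoint, positive and trace class. Fix, once and for all, an orthonormal basis $\{\gamma_j\}_{j\ge1}$ of $H$ (the Karhunen--Loève basis) with $\mathsf K\gamma_j=\lambda_j\gamma_j$, $\lambda_1\ge\lambda_2\ge\cdots$, and assume $\lambda_j>0$ for all $j$. Let $m_\Delta=m_2-m_1=\sum_j\nu_j\gamma_j$. Fix $0<\alpha<1$ and set $\rho=\alpha(1-\alpha)$, $\pi_1=\alpha$, $\pi_2=1-\alpha$, $a_1=-(1-\alpha)$, $a_2=\alpha$. For $q\ge1$ let $H_q=\operatorname{span}\{\gamma_1,\dots,\gamma_q\}$, $\Pi_q$ the orthogonal projection onto $H_q$, $\mathsf K_q=\Pi_q\mathsf K\Pi_q$ (positive definite on $H_q$), $\mathsf K_q^\dagger$ its Moore--Penrose inverse and $\mathsf K_q^{\dagger/2}=(\mathsf K_q^\dagger)^{1/2}$ (on $H_q$ these are $\mathsf K_q^{-1}$ and $\mathsf K_q^{-1/2}$). Put \[ m_{\Delta,q}=\Pi_qm_\Delta,\qquad \widetilde m_{\Delta,q}=\mathsf K_q^{-1/2}m_{\Delta,q}=\sum_{j=1}^q\widetilde\nu_j\gamma_j,\qquad\widetilde\nu_j=\nu_j/\sqrt{\lambda_j}.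 \] Let $\zeta_{\ell j}=\langle X_\ell-m_\ell,\gamma_j\rangle_H/\sqrt{\lambda_j}$; for each $\ell$, these are independent standard Gaussian variables. Define \[ \widetilde{\mathsf V}^{(2)}_{\ell,q}=\sum_{j,k=1}^{q}\bigl(\zeta_{\ell j}\zeta_{\ell k}+a_\ell^2\widetilde\nu_j\widetilde\nu_k\bigr)(\gamma_j\otimes\gamma_k), \qquad \widetilde{\mathsf V}_q^{(4)}=\sum_{\ell=1}^2\pi_\ell\,\mathbb E\bigl(\widetilde{\mathsf V}^{(2)}_{\ell,q}\otimes\widetilde{\mathsf V}^{(2)}_{\ell,q}\bigr), \] with coefficients \[ \widetilde V^{(q)}_{jkmn}=\sum_{\ell=1}^2\pi_\ell\,\mathbb E\bigl[(\zeta_{\ell j}\zeta_{\ell k}+a_\ell^2\widetilde\nu_j\widetilde\nu_k)(\zeta_{\ell m}\zeta_{\ell n}+a_\ell^2\widetilde\nu_m\widetilde\nu_n)\bigr] \] with respect to $\gamma_j\otimes\gamma_k\otimes\gamma_m\otimes\gamma_n$. Put $\kappa_{j,q}=\widetilde V^{(q)}_{jjjj}$, $j=1,\dots,q$. The induced coordinatewise operator on $H_q$ (relative to the fixed basis) is \[ \widetilde{\mathsf K}_{4,q}=\sum_{j=1}^q\kappa_{j,q}\,(\gamma_j\otimes\gamma_j). \] *)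

(* Defs.v *)
Set Warnings "-notation-overridden,-ambiguous-paths,-notation-incompatible-prefix".
From HB Require Import structures.
From mathcomp Require Import all_boot all_order all_algebra.
From mathcomp Require Import all_classical all_reals all_analysis.

Set Implicit Arguments.
Unset Strict Implicit.
Unset Printing Implicit Defensive.

Import Order.TTheory GRing.Theory Num.Theory.
Import numFieldNormedType.Exports.

Local Open Scope classical_set_scope.
Local Open Scope ring_scope.

(* Lebesgue measure on [0, 1], as a measure on the whole line that does not
   charge the complement of [0, 1]. *)
Definition mu01 (R : realType) : {measure set (measurableTypeR R) -> \bar R} :=
  mrestr lebesgue_measure (measurable_itv `[0%R, 1%R]%R).

(* Elements of L^2([0, 1]) are given by square-integrable representatives, and
   equality in L^2([0, 1]) is the relation [eqL2]. Identities between operators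
   are therefore also stated up to [eqL2]. *)
Definition L2 (R : realType) := LfunType (mu01 R) (lee1n 2).

Definition eqL2 (R : realType) (f g : L2 R) : Prop := f = g %[ae mu01 R].

Notation "f =L2 g" := (eqL2 f g) (at level 70, no associativity).

Definition inner (R : realType) (f g : L2 R) : R :=
  \int[mu01 R]_x (f x * g x).

Definition normL2 (R : realType) (f : L2 R) : \bar R :=
  'N[mu01 R]_2%:E[EFin \o f].

Definition tensor (R : realType) (f g : L2 R) : L2 R -> L2 R :=
  fun h => inner h g *: f.

Definition orthonormal_basis (R : realType) (e : nat -> L2 R) : Prop :=
  (forall i j, inner (e i) (e j) = (i == j)%:R) /\
  (forall f : L2 R,
     normL2 (f - \sum_(j < n) inner f (e j) *: e j) @[n --> \oo] --> 0%E).

Section Operators.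
Context {R : realType}.
Implicit Types A B S : L2 R -> L2 R.

Definition eq_op_L2 A B : Prop := forall f, A f =L2 B f.

(* A is well defined on classes modulo [eqL2], and linear there. *)
Definition linear_op A : Prop :=
  (forall f g, f =L2 g -> A f =L2 A g) /\
  (forall (a : R) f g, A (a *: f + g) =L2 a *: A f + A g).

Definition self_adjoint A : Prop := forall f g, inner (A f) g = inner f (A g).

Definition positive_op A : Prop := forall f, 0 <= inner (A f) f.

(* For positive A, where A = |A|. *)
Definition trace_class_pos A : Prop :=
  forall e, orthonormal_basis e ->
    (\sum_(0 <= j <oo) (inner (A (e j)) (e j))%:E < +oo)%E.

Definition is_mp_inverse A B : Prop :=
  linear_op B /\
  [/\ eq_op_L2 (A \o B \o A) A,
      eq_op_L2 (B \o A \o B) B,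
      self_adjoint (A \o B) &
      self_adjoint (B \o A)].

Definition mp_inverse A : L2 R -> L2 R := xget (idfun : L2 R -> L2 R) [set B | is_mp_inverse A B].

Definition is_positive_sqrt A S : Prop :=
  [/\ linear_op S, self_adjoint S, positive_op S & eq_op_L2 (S \o S) A].

Definition positive_sqrt A : L2 R -> L2 R := xget (idfun : L2 R -> L2 R) [set S | is_positive_sqrt A S].

Definition eigenfunction A (f : L2 R) : Prop :=
  ~ (f =L2 0) /\ exists a : R, A f =L2 a *: f.

Definition covariance_kernel (k : R -> R -> R) : Prop :=
  (forall s t, s \in `[0, 1] -> t \in `[0, 1] -> k s t = k t s) /\
  (forall n (t c : 'I_n -> R), (forall i, t i \in `[0, 1]) ->
     0 <= \sum_(i < n) \sum_(j < n) c i * c j * k (t i) (t j)).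

Definition induced_by A (k : R -> R -> R) : Prop :=
  forall f : L2 R,
    {ae mu01 R, forall s,
       A f s = \int[lebesgue_measure]_(t in `[0, 1]) (k s t * f t)}.

Definition covariance_operator A : Prop :=
  (exists k : R -> R -> R,
     [/\ {within `[0, 1] `*` `[0, 1], continuous (fun p : R * R => k p.1 p.2)},
         covariance_kernel k & induced_by A k]) /\
  [/\ linear_op A, self_adjoint A, positive_op A & trace_class_pos A].

End Operators.

(* [normal_prob] takes the standard deviation, and only has the Gaussian
   density when the latter is nonzero. *)
Definition gaussian_law (R : realType) (m v : R) : set R -> \bar R :=
  if v == 0 then \d_m else normal_prob m (Num.sqrt v).

(* Weak measurability is Borel measurability, since H is separable. *)
Definition gaussian_element d (T : measurableType d) (R : realType)
    (P : probability T R) (X : T -> L2 R) (m : L2 R) (K : L2 R -> L2 R) : Prop :=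
  [/\ forall h, measurable_fun [set: T] (fun w => inner (X w) h),
      forall h, exists a v : R, 0 <= v /\
        forall B : set R, measurable B ->
          P ((fun w => inner (X w) h) @^-1` B) = gaussian_law a v B,
      forall h, ('E_P[fun w => inner (X w) h] = (inner m h)%:E)%E &
      forall f g,
        covariance P (fun w => inner (X w) f) (fun w => inner (X w) g)
          = (inner (K f) g)%:E].

(* Indices start at 0: gam j and lam j stand for gamma_{j+1} and lambda_{j+1},
   and the groups 1, 2 are the elements 0, 1 of 'I_2. *)
Section Discriminant.
Context d (T : measurableType d) (R : realType) (P : probability T R).
Variables (X : 'I_2 -> T -> L2 R) (m : 'I_2 -> L2 R) (K : L2 R -> L2 R).
Variables (gam : nat -> L2 R) (lam : nat -> R) (alpha : R).

Definition rho : R := alpha * (1 - alpha).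

Definition prior (l : 'I_2) : R := if l == 0 then alpha else 1 - alpha.

Definition acoef (l : 'I_2) : R := if l == 0 then - (1 - alpha) else alpha.

Definition mDelta : L2 R := m 1 - m 0.

Definition nu (j : nat) : R := inner mDelta (gam j).

Definition nut (j : nat) : R := nu j / Num.sqrt (lam j).

Definition proj_q (q : nat) (f : L2 R) : L2 R :=
  \sum_(j < q) inner f (gam j) *: gam j.

Definition Kq (q : nat) : L2 R -> L2 R := proj_q q \o K \o proj_q q.

Definition Kq_pinv (q : nat) : L2 R -> L2 R := mp_inverse (Kq q).

Definition Kq_pinv_half (q : nat) : L2 R -> L2 R := positive_sqrt (Kq_pinv q).

Definition mDelta_q (q : nat) : L2 R := proj_q q mDelta.

(* K_q^{-1/2} m_{Delta,q}: on span(gam 0, ..., gam q.-1), [Kq_pinv_half] is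
   K_q^{-1/2}. *)
Definition mDeltat_q (q : nat) : L2 R := Kq_pinv_half q (mDelta_q q).

Definition zeta (l : 'I_2) (j : nat) (w : T) : R :=
  inner (X l w - m l) (gam j) / Num.sqrt (lam j).

(* Coefficient of gamma_j (x) gamma_k in V^(2)_{l,q}, for j, k < q. *)
Definition V2coef (l : 'I_2) (j k : nat) (w : T) : R :=
  zeta l j w * zeta l k w + acoef l ^+ 2 * nut j * nut k.

(* Coefficient of gamma_j (x) gamma_k (x) gamma_m (x) gamma_n in V^(4)_q, for
   j, k, m, n < q; it does not depend on q. *)
Definition V4coef (j k m n : nat) : R :=
  \sum_(l < 2) prior l *
    fine ('E_P[fun w => (V2coef l j k w * V2coef l m n w)%R])%E.

Definition kappa (j : nat) : R := V4coef j j j j.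

Definition K4q (q : nat) : L2 R -> L2 R :=
  fun h => \sum_(j < q) kappa j *: tensor (gam j) (gam j) h.

Definition beta_q (q : nat) : L2 R := Kq_pinv q (mDelta_q q).

End Discriminant.

(* Main.v *)
Require Import Defs.
Set Warnings "-notation-overridden,-ambiguous-paths,-notation-incompatible-prefix".
From HB Require Import structures.
From mathcomp Require Import all_boot all_order all_algebra.
From mathcomp Require Import all_classical all_reals all_analysis.
From mathcomp Require Import measurable_realfun ring lra.
Import Order.TTheory GRing.Theory Num.Theory.
Import numFieldNormedType.Exports.
Local Open Scope ring_scope.

Set Implicit Arguments.
Unset Strict Implicit.

(** In the basis [gam] everything is diagonal: [K_q] multiplies the [j]-th
    coordinate by [lam j], hence [beta_q] has coordinates [nut j / sqrt (lam j)],
    and [K4q] multiplies the [j]-th coordinate by [kappa j]. The fourth moment of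
    a standard Gaussian gives [kappa j = phi (nut j ^+ 2)] with
    [phi t = 3 + 2 rho t + rho (1 - 3 rho) t^2]. Since [0 < rho <= 1/4], [phi] is
    strictly increasing on nonnegative reals, so [kappa] is constant on the support
    of [beta_q] exactly when [nut j ^+ 2] is. *)

(** * Gaussian integrals *)

Section gauss_moments.
Local Open Scope classical_set_scope.
Context {R : realType}.
Let mu : {measure set _ -> \bar R} := @lebesgue_measure R.
Import gauss_integral_proof.

Lemma is_derive_gauss_fun (x : R) :
  is_derive x 1 gauss_fun (- (2 * x * gauss_fun x)).
Proof.
have H : is_derive x 1 (fun y : R => - y ^+ 2) (- (2 * x)).
  apply: is_derive_eq; rewrite /GRing.scale/=; ring.
have := @is_derive1_comp R expR (fun y : R => - y ^+ 2) x _ _ (is_derive_expR _) H.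
by rewrite mulrN mulrC.
Qed.

Lemma is_derive_integral0_gauss (x : R) : 0 < x ->
  is_derive x 1 (@integral0_gauss R) (gauss_fun x).
Proof.
move=> x0.
have int : lebesgue_measure.-integrable `[0, x + 1] (EFin \o @gauss_fun R).
  exact: integrableS integrableT_gauss.
have xx1 : x < x + 1 by rewrite ltrDl.
have [d e] := @continuous_FTC1_closed R _ 0 x (x + 1) xx1 int x0 (@continuous_gauss_fun R x).
rewrite derive1E in e; exact: (DeriveDef d e).
Qed.

(** The square of [integral0_gauss] is known to tend to [pi / 4]; since [integral0_gauss] is
    nonnegative, taking square roots loses nothing. *)
Lemma cvg_integral0_gauss :
  @integral0_gauss R x @[x --> +oo] --> Num.sqrt pi / 2.
Proof.
have : Num.sqrt (@integral0_gauss R x ^+ 2) @[x --> +oo] --> Num.sqrt (pi / 4).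
  apply: continuous_cvg; first exact: sqrt_continuous.
  exact: cvg_integral0_gauss_sqr.
rewrite sqrtrM ?pi_ge0// sqrtrV// (_ : 4 = 2 ^+ 2); last by rewrite expr2 -natrM.
rewrite sqrtr_sqr ger0_norm//; apply: cvg_trans; apply: near_eq_cvg.
by near=> r; rewrite sqrtr_sqr ger0_norm// integral0_gauss_ge0.
Unshelve. all: end_near. Qed.

(** Squeeze between 0 and [4 / x]. Powers up to 3 are the boundary terms produced by integrating
    [x ^+ 4 * gauss_fun x] by parts. *)
Lemma cvg_exprM_gauss_fun (n : nat) : (n <= 3)%N ->
  x ^+ n * gauss_fun x @[x --> +oo] --> (0 : R).
Proof.
move=> n3; apply: (@squeeze_cvgr _ _ _ _ (cst 0) (fun x => 4 * x^-1)).
- near=> x.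
  have x1 : 1 <= x by near: x; exact: nbhs_pinfty_ge.
  have x0 : 0 < x by rewrite (lt_le_trans _ x1).
  rewrite mulr_ge0 ?gauss_fun_ge0 ?exprn_ge0 ?(ltW x0)//=.
  (* Write the exponential as the square of [expR (x ^+ 2 / 2)], and bound each factor below by
     [x ^+ 2 / 2]. *)
  have h : x ^+ 4 / 4 <= expR (x ^+ 2).
    have -> : x ^+ 2 = x ^+ 2 / 2 + x ^+ 2 / 2 by field.
    rewrite expRD; have := expR_ge1Dx (x ^+ 2 / 2).
    have : 0 <= x ^+ 2 / 2 by rewrite divr_ge0 ?sqr_ge0.
    have -> : x ^+ 4 / 4 = (x ^+ 2 / 2) * (x ^+ 2 / 2) by field.
    by move=> t0 et; apply: ler_pM => //; apply: le_trans et; rewrite lerDr.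
  rewrite /gauss_fun expRN ler_pdivrMr ?expR_gt0//.
  apply: (@le_trans _ _ (x ^+ 3)); first by rewrite ler_eXn2l.
  rewrite mulrAC ler_pdivlMr// -exprSr.
  by move: h; rewrite ler_pdivrMr// mulrC.
- exact: cvg_cst.
- rewrite -[X in _ --> X](mulr0 4); apply: cvgM; first exact: cvg_cst.
  apply/gtr0_cvgV0; first by near=> x.
  exact: cvg_id.
Unshelve. all: end_near. Qed.

Lemma integral_gauss_even_poly (c0 c1 c2 : R) :
  0 <= c0 -> 0 <= c1 -> 0 <= c2 ->
  (\int[mu]_(x in `[0%R, +oo[)
     ((c0 + c1 * x ^+ 2 + c2 * x ^+ 4) * gauss_fun x)%:E =
   ((c0 + c1 / 2 + 3 / 4 * c2) * (Num.sqrt pi / 2))%:E)%E.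
Proof.
move=> c00 c10 c20.
(* [F] integrates the two higher monomials by parts, reducing them to the first one. *)
pose k := c1 / 2 + 3 / 4 * c2.
pose F (x : R) := (c0 + k) * integral0_gauss x
   - (k * (x ^+ 1 * gauss_fun x) + c2 / 2 * (x ^+ 3 * gauss_fun x)).
have cg : continuous (fun x : R =>
    (c0 + c1 * x ^+ 2 + c2 * x ^+ 4) * gauss_fun x).
  move=> x; apply: cvgM; last exact: continuous_gauss_fun.
  by apply: cvgD; [apply: cvgD; [exact: cvg_cst|]|];
    (apply: cvgM; [exact: cvg_cst|exact: exprn_continuous]).
have F0 : F 0 = 0.
  rewrite /F /integral0_gauss set_itv1 Rintegral_set1.
  by rewrite !expr0n /= !mul0r !mulr0 addr0 subrr.
have dF (x : R) : 0 < x -> is_derive x 1 F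
    ((c0 + c1 * x ^+ 2 + c2 * x ^+ 4) * gauss_fun x).
  move=> x0; have ? := is_derive_integral0_gauss x0.
  have ? := is_derive_gauss_fun x.
  have ? : is_derive x 1 (@GRing.exp R ^~ 1%N) 1.
    have -> : @GRing.exp R ^~ 1%N = id by apply/funext => y; rewrite expr1.
    exact: is_derive_id.
  have ? : is_derive x 1 (@GRing.exp R ^~ 3%N) (3 * x ^+ 2).
    by apply: is_derive_eq; rewrite /GRing.scale/=; ring.
  apply: is_derive_eq; rewrite /GRing.scale/= /k.
  by move: (gauss_fun x) => g; field.
rewrite (@ge0_continuous_FTC2y R _ F 0 ((c0 + k) * (Num.sqrt pi / 2))).
- by rewrite F0 sube0 /k addrA.
- move=> x x0; rewrite mulr_ge0 ?gauss_fun_ge0// !addr_ge0// mulr_ge0//.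
  + exact: sqr_ge0.
  + by rewrite exprn_ge0.
- exact: continuous_subspaceT.
- have -> : (c0 + k) * (Num.sqrt pi / 2) =
      (c0 + k) * (Num.sqrt pi / 2) - (k * 0 + c2 / 2 * 0) by ring.
  apply: cvgB; first by apply: cvgM; [exact: cvg_cst|exact: cvg_integral0_gauss].
  by apply: cvgD; apply: cvgM;
    [exact: cvg_cst|exact: (@cvg_exprM_gauss_fun 1 isT)|
     exact: cvg_cst|exact: (@cvg_exprM_gauss_fun 3 isT)].
- by move=> x /dF [].
- have cxg n : (x : R) ^+ n * gauss_fun x @[x --> 0^'+] --> (0 : R) ^+ n * gauss_fun 0.
    apply: cvg_at_right_filter; apply: cvgM; last exact: continuous_gauss_fun.
    exact: exprn_continuous.
  apply: cvgB; last by apply: cvgD; (apply: cvgM; [exact: cvg_cst|exact: cxg]).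
  apply: cvgM; first exact: cvg_cst.
  rewrite /integral0_gauss set_itv1 Rintegral_set1.
  apply: cvg_at_right_filter; apply: (@parameterized_integral_cvg_left _ 0 1) => //.
  exact: integrableS integrableT_gauss.
- move=> x; rewrite in_itv/= andbT => /dF [_ <-].
  by rewrite derive1E.
Qed.

(* Folding the line onto the half line keeps only the even part of [h]. *)
Lemma ge0_integralT_gauss_fold (h : R -> R) : continuous h ->
  (forall x, 0 <= h x) ->
  (\int[mu]_x (h x * gauss_fun x)%:E =
   \int[mu]_(x in `[0%R, +oo[) ((h x + h (- x)) * gauss_fun x)%:E)%E.
Proof.
move=> ch h0.
pose G x := h x * gauss_fun x.
have G0 x : 0 <= G x by rewrite mulr_ge0 ?gauss_fun_ge0.
have cG : continuous G.
  by move=> x; apply: cvgM; [exact: ch|exact: continuous_gauss_fun].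
have mG : measurable_fun [set: R] G by exact: continuous_measurable_fun.
have mGN : measurable_fun [set: R] (G \o -%R) by exact: measurableT_comp.
transitivity (\int[mu]_x (G x)%:E)%E; first by [].
rewrite -{1}(setUv `[0, +oo[%classic) ge0_integral_setU//=; last 4 first.
- exact: measurableC.
- by rewrite setUv; exact/measurable_EFinP.
- by move=> x _; rewrite lee_fin; exact: G0.
- exact/disj_setPCl.
rewrite setCitvr integral_itv_bndo_bndc; last exact/measurable_EFinP/measurable_funTS.
rewrite -{2}oppr0 ge0_integration_by_substitutionNy//; last exact: continuous_subspaceT.
rewrite -ge0_integralD//=.
- apply: eq_integral => x _; rewrite -EFinD /G/=; congr EFin.
  have -> : gauss_fun (- x) = gauss_fun x by rewrite /gauss_fun sqrrN.
  by rewrite mulrDl.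
- by move=> x _; rewrite lee_fin; exact: G0.
- exact/measurable_EFinP/measurable_funTS.
- by move=> x _; rewrite lee_fin; exact: G0.
- exact/measurable_EFinP/measurable_funTS.
Qed.

End gauss_moments.

(** * Even moments of the normal distribution *)

Section normal_expectation.
Local Open Scope classical_set_scope.
Context {R : realType}.
Local Notation mu := (@lebesgue_measure R).

Lemma ge0_integral_normal_prob (a s : R) (h : R -> R) :
  continuous h -> (forall x, 0 <= h x) ->
  (\int[normal_prob a s]_x (h x)%:E = \int[mu]_x (h x * normal_pdf a s x)%:E)%E.
Proof.
move=> ch h0; have mh : measurable_fun [set: R] h by exact: continuous_measurable_fun.
have dom := normal_prob_dominates a s.
rewrite -(Radon_Nikodym_SigmaFinite.change_of_variables dom)//=; last first.
  exact/measurable_EFinP.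
apply: ae_eq_integral => //.
- apply: emeasurable_funM; first exact/measurable_EFinP.
  exact: measurable_int (Radon_Nikodym_SigmaFinite.f_integrable dom).
- apply/measurable_EFinP; apply: measurable_funM => //.
  exact: measurable_normal_pdf.
(* The Radon-Nikodym derivative and [normal_pdf] agree almost everywhere, because both integrate to
   [normal_prob a s E] over each measurable [E]. *)
under [X in ae_eq _ _ _ X]eq_fun do rewrite EFinM.
apply: ae_eqe_mul2l; apply: integral_ae_eq => //=.
- exact: Radon_Nikodym_SigmaFinite.f_integrable.
- by apply/measurable_EFinP; exact: measurable_normal_pdf.
- by move=> E _ mE; rewrite -Radon_Nikodym_SigmaFinite.f_integral.
Qed.

Lemma ge0_integral_normal_prob_gauss (a s : R) (h : R -> R) : 0 < s ->
  continuous h -> (forall x, 0 <= h x) ->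
  (\int[normal_prob a s]_x (h ((x - a) / s))%:E =
   (Num.sqrt pi)^-1%:E * \int[mu]_x (h (Num.sqrt 2 * x) * gauss_fun x)%:E)%E.
Proof.
move=> s0 ch h0.
have r2 : 0 < Num.sqrt 2 :> R by rewrite sqrtr_gt0.
(* The substitution [F x = (x - a) / (s * Num.sqrt 2)] turns the normal exponent into that of
   [gauss_fun]; the slope [k] and the normalising peak leave the factor [1 / Num.sqrt pi]. *)
pose k : R := (s * Num.sqrt 2)^-1.
have k0 : 0 < k by rewrite invr_gt0 mulr_gt0.
pose F (x : R) : R := k * (x - a).
have dF (x : R) : is_derive x 1 F k.
  by apply: is_derive_eq; rewrite /GRing.scale/=; ring.
have F' : F^`() = cst k.
  by apply/funext => x; rewrite derive1E; case: (dF x).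
pose G x := h (Num.sqrt 2 * x) * gauss_fun x.
have cG : continuous G.
  move=> x; apply: cvgM; last exact: continuous_gauss_fun.
  apply: (@continuous_comp _ _ _ (fun x => Num.sqrt 2 * x) h); last exact: ch.
  exact: mulrl_continuous.
have G0 x : 0 <= G x by rewrite mulr_ge0 ?gauss_fun_ge0.
rewrite -[X in (_ * X)%E]/(\int[mu]_x (G x)%:E)%E.
rewrite (@increasing_ge0_integration_by_substitutionT _ F)//; last 6 first.
- by move=> x y xy; rewrite /F ltr_pM2l// ltrD2r.
- by rewrite F' => ?; exact: cvg_cst.
- by rewrite F'; exact: is_cvg_cst.
- by rewrite F'; exact: is_cvg_cst.
- by apply/gt0_cvgMrNy => //; exact: cvg_addrr_Ny.
- by apply/gt0_cvgMry => //; exact: cvg_addrr.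
rewrite -ge0_integralZl_EFin//=; last 2 first.
- move=> x _; rewrite lee_fin F' mulr_ge0//; [exact: G0|exact: ltW].
- apply/measurable_EFinP; rewrite F'; apply: measurable_funM => //.
  apply: measurableT_comp; first exact: continuous_measurable_fun.
  by apply: measurable_funM => //; exact: measurable_funB.
rewrite ge0_integral_normal_prob//; last first.
  move=> x; apply: (@continuous_comp _ _ _ (fun x => (x - a) / s) h); last exact: ch.
  by apply: cvgM; [apply: cvgB; [exact: cvg_id|exact: cvg_cst]|exact: cvg_cst].
apply: eq_integral => x _; rewrite -EFinM; congr EFin.
rewrite F' -[X in _ = _ * X]/(h (Num.sqrt 2 * (k * (x - a))) * gauss_fun (k * (x - a)) * k).
rewrite normal_pdfE ?gt_eqF// /normal_peak /normal_fun.
have -> : Num.sqrt 2 * (k * (x - a)) = (x - a) / s.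
  by rewrite /k; field; rewrite !gt_eqF.
have -> : - (x - a) ^+ 2 / (s ^+ 2 *+ 2) = - (k * (x - a)) ^+ 2.
  have -> : s ^+ 2 *+ 2 = (s * Num.sqrt 2) ^+ 2.
    by rewrite exprMn sqr_sqrtr ?mulr_natr.
  by rewrite /k; field; rewrite !gt_eqF.
have -> : Num.sqrt (s ^+ 2 * pi *+ 2) = s * Num.sqrt 2 * Num.sqrt pi.
  rewrite -[X in Num.sqrt X]mulr_natr (sqrtrM 2) ?(mulr_ge0 (sqr_ge0 s) (pi_ge0 R))//.
  rewrite (sqrtrM pi) ?sqr_ge0//.
  by rewrite sqrtr_sqr gtr0_norm// mulrAC.
rewrite invfM -/k /gauss_fun; ring.
Qed.

(** A symmetric law sees only the even part of [h], which is half of [h x + h (- x)]; the standard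
    normal moments of order 0, 2 and 4 are 1, 1 and 3. *)
Lemma ge0_integral_standard_normal (a s c0 c1 c2 : R) (h : R -> R) : 0 < s ->
  continuous h -> (forall x, 0 <= h x) ->
  0 <= c0 -> 0 <= c1 -> 0 <= c2 ->
  (forall x, h x + h (- x) = c0 + c1 * x ^+ 2 + c2 * x ^+ 4) ->
  (\int[normal_prob a s]_x (h ((x - a) / s))%:E =
   ((c0 + c1 + 3 * c2) / 2)%:E)%E.
Proof.
move=> s0 ch h0 c00 c10 c20 hE; rewrite ge0_integral_normal_prob_gauss//.
rewrite (@ge0_integralT_gauss_fold _ (fun x => h (Num.sqrt 2 * x)))//; last first.
  move=> x; apply: (@continuous_comp _ _ _ (fun x => Num.sqrt 2 * x) h); last exact: ch.
  exact: mulrl_continuous.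
have s2 : Num.sqrt 2 ^+ 2 = 2 :> R by rewrite sqr_sqrtr.
(* Rescaling by [Num.sqrt 2] multiplies the coefficients of degree 2 and 4 by 2 and 4. *)
transitivity ((Num.sqrt pi)^-1%:E * \int[mu]_(x in `[0%R, +oo[)
    ((c0 + (2 * c1) * x ^+ 2 + (4 * c2) * x ^+ 4) * gauss_fun x)%:E)%E.
  congr (_ * _)%E; apply: eq_integral.
  move=> x _; rewrite mulrN hE.
  have -> : (Num.sqrt 2 * x) ^+ 2 = 2 * x ^+ 2 by rewrite exprMn s2.
  have -> : (Num.sqrt 2 * x) ^+ 4 = 4 * x ^+ 4.
    by rewrite exprMn (exprM (Num.sqrt 2) 2 2) s2; congr (_ * _); ring.
  by congr (_ * _)%:E; ring.
rewrite integral_gauss_even_poly ?mulr_ge0// -EFinM; congr EFin.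
have : 0 < Num.sqrt pi :> R by rewrite sqrtr_gt0 pi_gt0.
by move=> p0; field; rewrite gt_eqF.
Qed.

End normal_expectation.

(** * Expectations of functions of a Gaussian random variable *)

Section gaussian_random_variable.
Local Open Scope classical_set_scope.
Context d (T : measurableType d) (R : realType) (P : probability T R).
Variable Y : T -> R.
Hypothesis mY : measurable_fun [set: T] Y.

Lemma ge0_expectation_normal (a s c0 c1 c2 : R) (h : R -> R) : 0 < s ->
  (forall B : set R, measurable B -> P (Y @^-1` B) = normal_prob a s B) ->
  continuous h -> (forall x, 0 <= h x) ->
  0 <= c0 -> 0 <= c1 -> 0 <= c2 ->
  (forall x, h x + h (- x) = c0 + c1 * x ^+ 2 + c2 * x ^+ 4) ->
  (\int[P]_w (h ((Y w - a) / s))%:E = ((c0 + c1 + 3 * c2) / 2)%:E)%E.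
Proof.
move=> s0 PY ch h0 c00 c10 c20 hE.
rewrite -(@ge0_integral_standard_normal _ a s c0 c1 c2 h)//.
pose X : {mfun T >-> measurableTypeR R} :=
  HB.pack Y (@isMeasurableFun.Build _ _ T (measurableTypeR R) Y mY).
have mh : measurable_fun [set: R] (fun y => h ((y - a) / s)).
  apply: measurableT_comp; first exact: continuous_measurable_fun.
  by apply: measurable_funM => //; exact: measurable_funB.
have := @ge0_integral_distribution _ _ T (measurableTypeR R) R P X (fun y => (h ((y - a) / s))%:E).
rewrite /= => <-; last 2 first.
- exact/measurable_EFinP.
- by move=> y; rewrite lee_fin.
(* After the change of variables, only the law of [Y] matters, and it agrees with [normal_prob a s]
   on measurable sets. *)
have e := @eq_measure_integral _ (measurableTypeR R) R [set: R] (normal_prob a s) (distribution P X).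
by apply: e => A mA _; exact: PY.
Qed.

(** [gaussian_element] provides some parameters [a] and [v] for each marginal law, with no stated
    link to its mean and covariance; this lemma identifies them. *)
Lemma gaussian_moments (a v m0 l : R) : 0 <= v -> 0 < l ->
  (forall B : set R, measurable B -> P (Y @^-1` B) = gaussian_law a v B) ->
  'E_P[Y]%E = m0%:E -> covariance P Y Y = l%:E -> a = m0 /\ v = l.
Proof.
move=> v0 l0 PY; move=> EY; rewrite unlock EY /= unlock.
move: EY; rewrite unlock /= => EY covE.
have [vE|vN0] := eqVneq v 0.
  (* In the degenerate case the law is a Dirac mass, so [Y] is almost surely constant and its
     variance is 0, against [0 < l]. *)
  have aeY : ae_eq P [set: T] Y (cst a).
    exists (Y @^-1` [set~ a]); split.
    - by rewrite -[_ @^-1` _]setTI; apply: mY => //; exact: measurableC.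
    - transitivity (gaussian_law a v [set~ a]).
        by apply: PY; exact: measurableC.
      by rewrite /gaussian_law vE eqxx diracE memNset//= => /(_ erefl).
    - by move=> x /= Yx; apply: contra_not Yx => ->.
  have a_m : a = m0.
    apply: EFin_inj; rewrite -EY (ae_eq_integral (cst a%:E))//.
    - by rewrite integral_cst//= probability_setT mule1.
    - exact/measurable_EFinP.
    - by apply: filterS aeY => x /= /(_ I) ->.
  move: covE; rewrite (ae_eq_integral (cst 0%E))//.
  - by rewrite integral0 => -[l00]; rewrite -l00 ltxx in l0.
  - by apply/measurable_EFinP; apply: measurable_funM; exact: measurable_funB.
  - by apply: filterS aeY => x /= /(_ I) Yx _; rewrite !fctE /= Yx a_m subrr mul0r.
have {vN0} {}v0 : 0 < v by rewrite lt_def vN0.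
pose s := Num.sqrt v.
have s0 : 0 < s by rewrite sqrtr_gt0.
have {}PY (B : set R) : measurable B -> P (Y @^-1` B) = normal_prob a s B.
  by move=> mB; rewrite PY// /gaussian_law gt_eqF.
pose Z w := (Y w - a) / s.
have mZ : measurable_fun [set: T] Z.
  by apply: measurable_funM => //; exact: measurable_funB.
have cX n : continuous (fun x : R => x ^+ n) by exact: exprn_continuous.
have Z2 : (\int[P]_w (Z w ^+ 2)%:E = 1%:E)%E.
  rewrite (@ge0_expectation_normal a s 0 2 0 (fun x => x ^+ 2))//; first by congr EFin; field.
  - by move=> x; exact: sqr_ge0.
  - by move=> x; ring.
have cX1 : continuous (fun x : R => (x + 1) ^+ 2).
  move=> x; have cx : {for x, continuous (fun x : R => x + 1)}.
    by apply: cvgD; [exact: cvg_id|exact: cvg_cst].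
  exact: (continuous_comp cx (@exprn_continuous R 2 (x + 1))).
(* The mean of [Z] is read off the second moments of [Z] and [Z + 1]. *)
have Z12 : (\int[P]_w ((Z w + 1) ^+ 2)%:E = 2%:E)%E.
  rewrite (@ge0_expectation_normal a s 2 2 0 (fun x => (x + 1) ^+ 2))//; first by congr EFin; field.
  - by move=> x; exact: sqr_ge0.
  - by move=> x; ring.
have i1 (c : R) : P.-integrable [set: T] (EFin \o cst c).
  exact: finite_measure_integrable_cst.
have iZ2 : P.-integrable [set: T] (EFin \o (fun w => Z w ^+ 2)).
  apply/integrableP; split; first by apply/measurable_EFinP; exact: measurable_funX.
  under eq_integral do rewrite /= ger0_norm ?sqr_ge0//.
  by rewrite Z2 ltry.
have iZ : P.-integrable [set: T] (EFin \o Z).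
  (* Domination by the elementary bound [|t| <= t ^+ 2 + 1]. *)
  apply: (le_integrable _ _ _ (integrableD _ iZ2 (i1 1))) => //.
    exact/measurable_EFinP.
  move=> w _; rewrite /= lee_fin (ger0_norm (addr_ge0 (sqr_ge0 _) ler01)).
  by rewrite -real_normK ?num_real//; move: `|Z w| => t; nra.
have iZl (c : R) : P.-integrable [set: T] (EFin \o (fun w => c * Z w)).
  exact: (integrableZl measurableT c iZ).
have EZl (c : R) : (\int[P]_w (c * Z w)%:E = c%:E * \int[P]_w (Z w)%:E)%E.
  by rewrite -integralZl.
have EZ : (\int[P]_w (Z w)%:E = 0)%E.
  move: Z12; under eq_integral.
    move=> w _; have -> : (Z w + 1) ^+ 2 = Z w ^+ 2 + (2 * Z w + 1) by ring.
    over.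
  rewrite /= integralD_EFin//; last first.
    exact: (integrableD measurableT (iZl 2) (i1 1)).
  rewrite integralD_EFin//; last exact: i1.
  rewrite EZl Z2 integral_cst//= probability_setT mule1.
  have := integrable_fin_num _ iZ => /(_ measurableT).
  rewrite /=; case: (\int[P]_w (Z w)%:E)%E => //= r _ [] hr.
  by congr EFin; lra.
have YE w : Y w = s * Z w + a by rewrite /Z; field; rewrite gt_eqF.
have a_m : a = m0.
  apply: EFin_inj; rewrite -EY; under [RHS]eq_integral do rewrite YE.
  rewrite /= integralD_EFin//; last exact: i1.
  by rewrite EZl EZ mule0 add0e integral_cst//= probability_setT mule1.
split=> //; apply: EFin_inj; rewrite -covE -a_m.
transitivity (\int[P]_w ((v * Z w ^+ 2)%:E))%E.
  rewrite (@ge0_expectation_normal a s 0 (2 * v) 0 (fun x => v * x ^+ 2))//.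
  - by congr EFin; field.
  - by move=> x; apply: cvgM; [exact: cvg_cst|exact: cX].
  - by move=> x; rewrite mulr_ge0 ?sqr_ge0// ltW.
  - by rewrite mulr_ge0// ltW.
  - by move=> x; ring.
apply: eq_integral => w _.
transitivity (((Y w - a) * (Y w - a))%:E); last by [].
rewrite YE -[v](@sqr_sqrtr _ v) ?ltW// -/s; congr EFin; ring.
Qed.

Lemma ge0_expectation_gaussian (m0 l c0 c1 c2 : R) (h : R -> R) : 0 < l ->
  (exists a v : R, 0 <= v /\
     forall B : set R, measurable B -> P (Y @^-1` B) = gaussian_law a v B) ->
  'E_P[Y]%E = m0%:E -> covariance P Y Y = l%:E ->
  continuous h -> (forall x, 0 <= h x) ->
  0 <= c0 -> 0 <= c1 -> 0 <= c2 ->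
  (forall x, h x + h (- x) = c0 + c1 * x ^+ 2 + c2 * x ^+ 4) ->
  ('E_P[fun w => h ((Y w - m0) / Num.sqrt l)%R] = ((c0 + c1 + 3 * c2) / 2)%:E)%E.
Proof.
move=> l0 [a [v [v0 PY]]] EY covE ch h0 c00 c10 c20 hE.
have [am vl] := gaussian_moments v0 l0 PY EY covE; rewrite unlock -am.
apply: ge0_expectation_normal => //; first by rewrite sqrtr_gt0.
by move=> B mB; rewrite PY// /gaussian_law vl gt_eqF.
Qed.

End gaussian_random_variable.

(** * Operators on L2 *)

Section L2_inner_product.
Local Open Scope classical_set_scope.
Context {R : realType}.
Implicit Types f g h : L2 R.

Lemma L2_integrableM f g : (mu01 R).-integrable [set: R] (EFin \o (fun x => f x * g x)).
Proof. by apply/Lfun1_integrable; apply: Lfun2_mul_Lfun1; exact: LfunP. Qed.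

Lemma innerC f g : inner f g = inner g f.
Proof. by apply: eq_Rintegral => x _; rewrite mulrC. Qed.

Lemma innerDl f g h : inner (f + g) h = inner f h + inner g h.
Proof.
rewrite /inner -RintegralD//; try exact: L2_integrableM.
by apply: eq_Rintegral => x _; rewrite mulrDl.
Qed.

Lemma innerZl (a : R) f g : inner (a *: f) g = a * inner f g.
Proof.
rewrite /inner -RintegralZl//; last exact: L2_integrableM.
by apply: eq_Rintegral => x _; rewrite mulrA.
Qed.

Lemma innerZr (a : R) f g : inner g (a *: f) = a * inner g f.
Proof. by rewrite innerC innerZl innerC. Qed.

Lemma innerBl f g h : inner (f - g) h = inner f h - inner g h.
Proof. by rewrite -scaleN1r innerDl innerZl mulN1r. Qed.

Lemma inner0l f : inner 0 f = 0.
Proof. by rewrite -(scale0r 0) innerZl mul0r. Qed.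

Lemma inner_suml n (F : 'I_n -> L2 R) g :
  inner (\sum_(j < n) F j) g = \sum_(j < n) inner (F j) g.
Proof.
by elim/big_rec2: _ => [|i x y _ <-]; rewrite ?inner0l ?innerDl.
Qed.

Lemma eqL2_refl f : f =L2 f.
Proof. exact: ae_eq_refl. Qed.

Lemma eqL2_sym f g : f =L2 g -> g =L2 f.
Proof. exact: ae_eq_sym. Qed.

Lemma eqL2_trans f g h : f =L2 g -> g =L2 h -> f =L2 h.
Proof. exact: ae_eq_trans. Qed.

Lemma eqL2D f f' g g' : f =L2 f' -> g =L2 g' -> f + g =L2 f' + g'.
Proof. by move=> ef eg; apply: filterS2 ef eg => x ef eg xI; congr +%R; [exact: ef|exact: eg]. Qed.

Lemma eqL2Z (a : R) f g : f =L2 g -> a *: f =L2 a *: g.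
Proof. by move=> e; apply: filterS e => x e xI; congr *%R; exact: e. Qed.

Lemma eqL2_sum n (F G : 'I_n -> L2 R) : (forall j, F j =L2 G j) ->
  \sum_(j < n) F j =L2 \sum_(j < n) G j.
Proof.
move=> FG; elim/big_rec2: _ => [|i x y _ e]; first exact: eqL2_refl.
exact: eqL2D.
Qed.

Lemma eqL2_innerl f g h : f =L2 g -> inner f h = inner g h.
Proof.
move=> e; rewrite /inner /Rintegral; congr fine; apply: ae_eq_integral => //.
- exact: measurable_int (L2_integrableM f h).
- exact: measurable_int (L2_integrableM g h).
- by apply: filterS e => x e xI; congr (_ * _)%:E; exact: e.
Qed.

Lemma eqL2_innerr f g h : f =L2 g -> inner h f = inner h g.
Proof. by move=> e; rewrite innerC (eqL2_innerl h e) innerC. Qed.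

Lemma inner_eq0 f : inner f f = 0 -> f =L2 0.
Proof.
move=> f0.
have int := L2_integrableM f f.
have : (\int[mu01 R]_x (f x * f x)%:E = 0)%E.
  by rewrite -[LHS]fineK ?(integrable_fin_num measurableT int)// -[fine _]/(inner f f) f0.
move=> f20.
have : ae_eq (mu01 R) [set: R] (fun x => (f x * f x)%:E) (cst 0%E).
  apply/(ae_eq_integral_abs _ measurableT); first exact: measurable_int int.
  rewrite -[RHS]f20; apply: eq_integral => x _.
  by rewrite gee0_abs// lee_fin -expr2 sqr_ge0.
apply: filterS => x /[apply] -[] /eqP; rewrite mulf_eq0 orbb => /eqP.
by [].
Qed.

End L2_inner_product.

(** * Moore-Penrose inverses and positive square roots modulo [eqL2] *)

Section operators.
Local Open Scope classical_set_scope.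
Context {R : realType}.
Implicit Types (f g h e : L2 R) (A B S : L2 R -> L2 R).

(** Testing against [f - g] itself shows that its norm vanishes. *)
Lemma eqL2_inner_ext f g : (forall h, inner f h = inner g h) -> f =L2 g.
Proof.
move=> fg; have : f - g =L2 0 by apply: inner_eq0; rewrite innerBl fg subrr.
apply: filterS => x e xI; apply/eqP; rewrite -subr_eq0; apply/eqP; exact: e.
Qed.

Lemma inner_ge0 f : 0 <= inner f f.
Proof. by apply: Rintegral_ge0 => x _; rewrite -expr2 sqr_ge0. Qed.

Lemma linear_op0 A : linear_op A -> A 0 =L2 0.
Proof.
move=> [_ /(_ (-1) 0 0)]; rewrite scaler0 addr0 scaleN1r addNr; exact.
Qed.

Lemma linear_op_sum A n (c : 'I_n -> R) (F : 'I_n -> L2 R) : linear_op A ->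
  A (\sum_(j < n) c j *: F j) =L2 \sum_(j < n) c j *: A (F j).
Proof.
move=> lA; elim/big_rec2: _ => [|i x y _ e]; first exact: linear_op0.
apply: eqL2_trans (lA.2 _ _ _) _; apply: eqL2D => //; exact: eqL2_refl.
Qed.

(** Penrose's argument: self-adjointness of the products yields [A B = A B'] and [B A = B' A],
    whence [B = B A B = B A B' = B' A B' = B']. It pins down the value that [mp_inverse] selects by
    [xget]. *)
Lemma mp_inverse_unique A B B' : linear_op A ->
  is_mp_inverse A B -> is_mp_inverse A B' -> eq_op_L2 B B'.
Proof.
move=> lA [lB [ABA BAB sAB sBA]] [lB' [ABA' BAB' sAB' sBA']].
have AB f : A (B f) =L2 A (B' f).
  apply: eqL2_inner_ext => g.
  rewrite -(eqL2_innerl g (ABA' (B f))) [LHS]sAB' [LHS]sAB.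
  by rewrite (eqL2_innerr f (ABA (B' g))) -[LHS]sAB'.
have BA f : B (A f) =L2 B' (A f).
  apply: eqL2_inner_ext => g.
  rewrite -(eqL2_innerl g (lB.1 _ _ (ABA' f))) [LHS](sBA (B' (A f))) [LHS](sBA' f).
  by rewrite (eqL2_innerr f (lB'.1 _ _ (ABA g))) -[LHS](sBA' f).
move=> f; apply: eqL2_trans (eqL2_sym (BAB f)) _.
apply: eqL2_trans (lB.1 _ _ (AB f)) _.
exact: eqL2_trans (BA (B' f)) (BAB' f).
Qed.

(* [h := S e - mu *: e] satisfies [S h = - mu *: h], so positivity forces [h = 0]. *)
Lemma positive_sqrt_eigen A S e (mu : R) : is_positive_sqrt A S -> 0 < mu ->
  A e =L2 mu ^+ 2 *: e -> S e =L2 mu *: e.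
Proof.
move=> [lS _ pS SS] mu0 Ae; pose h := - mu *: e + S e.
have Sh : S h =L2 - mu *: h.
  apply: eqL2_trans (lS.2 _ _ _) _.
  have -> : - mu *: h = - mu *: S e + mu ^+ 2 *: e.
    by rewrite scalerDr scalerA mulrNN -expr2 addrC.
  by apply: eqL2D; [exact: eqL2_refl|exact: eqL2_trans (SS e) Ae].
have : h =L2 0.
  apply: inner_eq0; apply/eqP; rewrite eq_le inner_ge0 andbT.
  have := pS h; rewrite (eqL2_innerl h Sh) innerZl mulNr oppr_ge0.
  by rewrite pmulr_rle0.
move=> h0; apply: eqL2_inner_ext => g.
have := eqL2_innerl g h0; rewrite innerDl !innerZl inner0l mulNr.
by move=> /eqP; rewrite addrC subr_eq0 => /eqP.
Qed.

End operators.

(** * Diagonal operators in an orthonormal family *)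

Section orthonormal.
Local Open Scope classical_set_scope.
Context {R : realType} (gam : nat -> L2 R).
Hypothesis gam_on : forall i j, inner (gam i) (gam j) = (i == j)%:R.
Variable q : nat.
Implicit Types (c x y : nat -> R) (f g : L2 R).

Definition lincomb x : L2 R := \sum_(j < q) x j *: gam j.

(** The operator with eigenvalues [c j] on the span of the first [q] vectors, extended by 0 to the
    orthogonal complement. *)
Definition diag_op c f : L2 R := lincomb (fun j => c j * inner f (gam j)).

Lemma eq_lincomb x y : (forall j, (j < q)%N -> x j = y j) -> lincomb x = lincomb y.
Proof. by move=> xy; apply: eq_bigr => j _; rewrite xy. Qed.

Lemma inner_lincomb x k : (k < q)%N -> inner (lincomb x) (gam k) = x k.
Proof.
move=> kq; rewrite inner_suml (bigD1 (Ordinal kq))//= innerZl gam_on eqxx mulr1.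
rewrite big1 ?addr0// => j jk; rewrite innerZl gam_on.
by rewrite (_ : _ == _ = false) ?mulr0//; apply: contraNF jk => /eqP jk; exact/eqP/val_inj.
Qed.

Lemma lincomb_inj x y : lincomb x =L2 lincomb y ->
  forall j, (j < q)%N -> x j = y j.
Proof.
by move=> xy j jq; have := eqL2_innerl (gam j) xy; rewrite !inner_lincomb.
Qed.

Lemma lincomb0 : lincomb (fun=> 0) = 0.
Proof. by apply: big1 => j _; rewrite scale0r. Qed.

Lemma scale_lincomb (a : R) x : a *: lincomb x = lincomb (fun j => a * x j).
Proof. by rewrite scaler_sumr; apply: eq_bigr => j _; rewrite scalerA. Qed.

Lemma lincombD x y : lincomb x + lincomb y = lincomb (fun j => x j + y j).
Proof. by rewrite -big_split; apply: eq_bigr => j _; rewrite scalerDl. Qed.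

Lemma diag_op_lincomb c x : diag_op c (lincomb x) = lincomb (fun j => c j * x j).
Proof. by apply: eq_lincomb => j jq; rewrite inner_lincomb. Qed.

Lemma eq_diag_op c f g : f =L2 g -> diag_op c f = diag_op c g.
Proof. by move=> fg; apply: eq_lincomb => j _; rewrite (eqL2_innerl _ fg). Qed.

Lemma inner_diag_op c f g : inner (diag_op c f) g =
  \sum_(j < q) c j * inner f (gam j) * inner g (gam j).
Proof.
by rewrite inner_suml; apply: eq_bigr => j _; rewrite innerZl (innerC _ g).
Qed.

Lemma linear_diag_op c : linear_op (diag_op c).
Proof.
split=> [f g /(eq_diag_op c) ->|a f g]; first exact: eqL2_refl.
have -> : diag_op c (a *: f + g) = a *: diag_op c f + diag_op c g.
  rewrite /diag_op scale_lincomb lincombD; apply: eq_lincomb => j _.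
  by rewrite innerDl innerZl mulrDr mulrCA.
exact: eqL2_refl.
Qed.

Lemma self_adjoint_diag_op c : self_adjoint (diag_op c).
Proof.
move=> f g; rewrite (innerC f) !inner_diag_op.
by apply: eq_bigr => j _; rewrite mulrAC.
Qed.

Lemma positive_diag_op c : (forall j, (j < q)%N -> 0 <= c j) ->
  positive_op (diag_op c).
Proof.
move=> c0 f; rewrite inner_diag_op; apply: sumr_ge0 => j _.
by rewrite -mulrA mulr_ge0 ?c0// -expr2 sqr_ge0.
Qed.

Lemma diag_op_comp c d f : diag_op c (diag_op d f) = diag_op (fun j => c j * d j) f.
Proof. by rewrite diag_op_lincomb; apply: eq_lincomb => j _; rewrite mulrA. Qed.

Lemma is_mp_inverse_diag_op c : (forall j, (j < q)%N -> c j != 0) ->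
  is_mp_inverse (diag_op c) (diag_op (fun j => (c j)^-1)).
Proof.
move=> c0; split; first exact: linear_diag_op.
split => f /=.
- rewrite !diag_op_comp; set u := diag_op _ f; set v := diag_op _ f.
  have -> : u = v; last exact: eqL2_refl.
  by apply: eq_lincomb => j jq; rewrite mulfV ?c0// mul1r.
- rewrite !diag_op_comp; set u := diag_op _ f; set v := diag_op _ f.
  have -> : u = v; last exact: eqL2_refl.
  by apply: eq_lincomb => j jq; rewrite mulVf ?c0// mul1r.
- by move=> g; rewrite !diag_op_comp self_adjoint_diag_op.
- by move=> g; rewrite !diag_op_comp self_adjoint_diag_op.
Qed.

Lemma mp_inverse_diag_op c : (forall j, (j < q)%N -> c j != 0) ->
  eq_op_L2 (mp_inverse (diag_op c)) (diag_op (fun j => (c j)^-1)).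
Proof.
move=> c0; have h := is_mp_inverse_diag_op c0.
apply: (mp_inverse_unique (linear_diag_op c) _ h).
(* A witness exists, so [xget] returns a Moore-Penrose inverse and not its default [idfun]. *)
exact: (@xgetPex _ (idfun : L2 R -> L2 R) [set B | is_mp_inverse (diag_op c) B] (ex_intro _ _ h)).
Qed.

(** The diagonal operator with entries [Num.sqrt (c j)] is a witness, which keeps [xget] away from
    its default. *)
Lemma positive_sqrtP (A : L2 R -> L2 R) c :
  (forall j, (j < q)%N -> 0 < c j) -> eq_op_L2 A (diag_op c) ->
  is_positive_sqrt A (positive_sqrt A).
Proof.
move=> c0 Ac.
suff h : is_positive_sqrt A (diag_op (fun j => Num.sqrt (c j))).
  exact: (@xgetPex _ (idfun : L2 R -> L2 R) [set S | is_positive_sqrt A S] (ex_intro _ _ h)).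
split.
- exact: linear_diag_op.
- exact: self_adjoint_diag_op.
- by apply: positive_diag_op => j _; exact: sqrtr_ge0.
- move=> f /=; apply: eqL2_trans (eqL2_sym (Ac f)); rewrite diag_op_comp.
  set u := diag_op _ f; set v := diag_op _ f.
  have -> : u = v; last exact: eqL2_refl.
  by apply: eq_lincomb => j jq; rewrite -expr2 sqr_sqrtr ?ltW ?c0.
Qed.

(** Each [gam j] with [j < q] is an eigenvector of [A] for [c j], so any positive square root scales
    it by [Num.sqrt (c j)]; linearity carries this to the span. *)
Lemma positive_sqrt_lincomb (A : L2 R -> L2 R) c f x :
  (forall j, (j < q)%N -> 0 < c j) -> eq_op_L2 A (diag_op c) ->
  f =L2 lincomb x ->
  positive_sqrt A f =L2 lincomb (fun j => Num.sqrt (c j) * x j).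
Proof.
move=> c0 Ac fx; have HS := positive_sqrtP c0 Ac.
move: (positive_sqrt A) HS => S HS; have [lS _ _ _] := HS.
apply: eqL2_trans (lS.1 _ _ fx) _.
apply: eqL2_trans (linear_op_sum _ _ lS) _; apply: eqL2_sum => j.
rewrite mulrC -scalerA; apply: eqL2Z.
apply: (positive_sqrt_eigen HS); first by rewrite sqrtr_gt0 c0.
apply: eqL2_trans (Ac _) _; rewrite sqr_sqrtr ?ltW ?c0// /diag_op /lincomb.
rewrite (bigD1 j)//= gam_on eqxx mulr1 big1 ?addr0; first exact: eqL2_refl.
move=> i ij; rewrite gam_on (_ : _ == _ = false) ?mulr0 ?scale0r//.
by apply: contraNF ij => /eqP ij; exact/eqP/val_inj.
Qed.

End orthonormal.

(** * The coordinatewise fourth moment operator *)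

Section discriminant.
Local Open Scope classical_set_scope.
Context d (T : measurableType d) (R : realType) (P : probability T R).
Variables (X : 'I_2 -> T -> L2 R) (m : 'I_2 -> L2 R) (K : L2 R -> L2 R).
Variables (gam : nat -> L2 R) (lam : nat -> R) (alpha : R).
Hypothesis X_gauss : forall l : 'I_2, gaussian_element P (X l) (m l) K.
Hypothesis gam_on : forall i j, inner (gam i) (gam j) = (i == j)%:R.
Hypothesis K_sa : self_adjoint K.
Hypothesis gam_eigen : forall j, K (gam j) =L2 lam j *: gam j.
Hypothesis lam_gt0 : forall j, 0 < lam j.

Local Notation nt := (nut m gam lam).
Local Notation r := (rho alpha).

Lemma expectation_V2coef_sqr (l : 'I_2) (j : nat) :
  let b := acoef alpha l ^+ 2 * nt j ^+ 2 in
  ('E_P[fun w => (V2coef X m gam lam alpha l j j w * V2coef X m gam lam alpha l j j w)%R]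
   = (3 + 2 * b + b ^+ 2)%:E)%E.
Proof.
move=> b; have [mX lawX EX covX] := X_gauss l.
have b0 : 0 <= b by rewrite mulr_ge0 ?sqr_ge0.
(* [h] is even, so [h x + h (- x)] is twice [b ^+ 2 + 2 * b * x ^+ 2 + x ^+ 4]; hence the
   coefficients [2 * b ^+ 2], [4 * b] and 2. *)
pose h (x : R) := (x * x + b) * (x * x + b).
have := @ge0_expectation_gaussian _ _ _ P _ (mX (gam j)) (inner (m l) (gam j))
  (lam j) (2 * b ^+ 2) (4 * b) 2 h (lam_gt0 j) (lawX _) (EX _) _ _ _ _ _ _ _.
rewrite (_ : (2 * b ^+ 2 + 4 * b + 3 * 2) / 2 = 3 + 2 * b + b ^+ 2); last by field.
move=> <-.
- congr expectation; apply/funext => w.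
  by rewrite /V2coef /zeta /h innerBl /b !expr2 !mulrA.
- by rewrite covX (eqL2_innerl _ (gam_eigen j)) innerZl gam_on eqxx mulr1.
- by move=> x; apply: cvgM; (apply: cvgD; [apply: cvgM; exact: cvg_id|exact: cvg_cst]).
- by move=> x; rewrite /h -expr2 sqr_ge0.
- by rewrite mulr_ge0 ?sqr_ge0.
- by rewrite mulr_ge0.
- by [].
- by move=> x; rewrite /h; ring.
Qed.

(** The prior-weighted averages of [acoef l ^+ 2] and [acoef l ^+ 4] are [r] and [r * (1 - 3 * r)],
    the latter because [alpha ^+ 3 + (1 - alpha) ^+ 3 = 1 - 3 * r]. *)
Lemma kappaE (j : nat) : kappa P X m gam lam alpha j =
  3 + 2 * r * nt j ^+ 2 + r * (1 - 3 * r) * (nt j ^+ 2) ^+ 2.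
Proof.
rewrite /kappa /V4coef big_ord_recl big_ord1 !expectation_V2coef_sqr /=.
by rewrite /prior /acoef /rho /=; move: (nt j) => t; ring.
Qed.

(** Self-adjointness moves [K] onto [gam j]. Since only the real coefficients have to be compared,
    the equality is literal and can be rewritten inside [mp_inverse]. *)
Lemma KqE (q : nat) : Kq K gam q = diag_op gam q lam.
Proof.
apply/funext => f.
apply: (@eq_lincomb _ _ _ (fun j => inner (K (proj_q gam q f)) (gam j))) => j jq.
rewrite K_sa (eqL2_innerr _ (gam_eigen j)) innerZr; congr (_ * _).
exact: (inner_lincomb gam_on (fun j => inner f (gam j))).
Qed.

Lemma Kq_pinvE (q : nat) :
  eq_op_L2 (Kq_pinv K gam q) (diag_op gam q (fun j => (lam j)^-1)).
Proof.
by rewrite /Kq_pinv KqE; apply: mp_inverse_diag_op => // j _; rewrite gt_eqF.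
Qed.

Lemma Kq_pinv_half_lincomb (q : nat) (f : L2 R) (x : nat -> R) :
  f =L2 lincomb gam q x ->
  Kq_pinv_half K gam q f =L2 lincomb gam q (fun j => x j / Num.sqrt (lam j)).
Proof.
move=> fx; apply: eqL2_trans (positive_sqrt_lincomb gam_on _ (@Kq_pinvE q) fx) _.
  by move=> j _; rewrite invr_gt0.
rewrite (eq_lincomb gam (y := fun j => x j / Num.sqrt (lam j))).
  exact: eqL2_refl.
by move=> j _; rewrite sqrtrV ?ltW// mulrC.
Qed.

Lemma mDelta_qE (q : nat) : mDelta_q m gam q = lincomb gam q (nu m gam).
Proof. by []. Qed.

Lemma mDeltat_qE (q : nat) : mDeltat_q m K gam q =L2 lincomb gam q nt.
Proof. by apply: Kq_pinv_half_lincomb; exact: eqL2_refl. Qed.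

Lemma beta_qE (q : nat) :
  beta_q m K gam q =L2 lincomb gam q (fun j => nt j / Num.sqrt (lam j)).
Proof.
apply: eqL2_trans (Kq_pinvE _ _) _; rewrite mDelta_qE diag_op_lincomb//.
rewrite (eq_lincomb gam (y := fun j => nt j / Num.sqrt (lam j))).
  exact: eqL2_refl.
move=> j _; rewrite /nut -mulrA -invfM -expr2 sqr_sqrtr ?ltW//.
by rewrite mulrC.
Qed.

Lemma K4q_lincomb (q : nat) (f : L2 R) (x : nat -> R) : f =L2 lincomb gam q x ->
  K4q P X m gam lam alpha q f =
  lincomb gam q (fun j => kappa P X m gam lam alpha j * x j).
Proof.
move=> fx; rewrite /K4q /tensor -(diag_op_lincomb gam_on) -(eq_diag_op _ _ _ fx).
by apply: eq_bigr => j _; rewrite scalerA.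
Qed.

End discriminant.

(** * Injectivity of the eigenvalue polynomial, and the characterisation *)

Lemma kappa_poly_inj (R : realFieldType) (r s t : R) : 0 < r -> 3 * r < 1 ->
  0 <= s -> 0 <= t ->
  3 + 2 * r * s + r * (1 - 3 * r) * s ^+ 2 =
  3 + 2 * r * t + r * (1 - 3 * r) * t ^+ 2 -> s = t.
Proof.
move=> r0 r1 s0 t0 e.
have st : 0 <= (1 - 3 * r) * (s + t) by rewrite mulr_ge0 ?(addr_ge0 s0 t0)// subr_ge0 ltW.
(* The difference of the two values factors, and the cofactor of [s - t] is positive. *)
have : (s - t) * (r * (2 + (1 - 3 * r) * (s + t))) = 0.
  by apply/eqP; move/eqP: e; rewrite -subr_eq0; congr (_ == 0); ring.
move=> /eqP; rewrite mulf_eq0 => /orP[|]; first by rewrite subr_eq0 => /eqP.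
by rewrite gt_eqF// mulr_gt0// ltr_wpDr.
Qed.

Theorem theorem3p3 (R : realType) (d : measure_display) (T : measurableType d)
    (P : probability T R) (X : 'I_2 -> T -> L2 R) (m : 'I_2 -> L2 R)
    (K : L2 R -> L2 R) (gam : nat -> L2 R) (lam : nat -> R) (alpha : R)
    (q : nat)
    (K_cov : covariance_operator K)
    (X_gauss : forall l : 'I_2, gaussian_element P (X l) (m l) K)
    (gam_basis : orthonormal_basis gam)
    (gam_eigen : forall j, K (gam j) =L2 lam j *: gam j)
    (lam_noninc : forall i j, (i <= j)%N -> lam j <= lam i)
    (lam_gt0 : forall j, 0 < lam j)
    (alpha_gt0 : 0 < alpha) (alpha_lt1 : alpha < 1)
    (q_ge1 : (1 <= q)%N)
    (mDelta_q_neq0 : ~ (mDelta_q m gam q =L2 0)) :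
  let nt := nut m gam lam in
  let mt := mDeltat_q m K gam q in
  let beta := beta_q m K gam q in
  let K4 := K4q P X m gam lam alpha q in
  let r := rho alpha in
  [/\ beta =L2 Kq_pinv_half K gam q mt,
      eigenfunction K4 beta <->
        (exists c : R, 0 < c /\
           forall j, (j < q)%N -> nt j != 0 -> nt j ^+ 2 = c),
      forall c : R, 0 < c ->
        (forall j, (j < q)%N -> nt j != 0 -> nt j ^+ 2 = c) ->
        K4 beta =L2 (3 + 2 * r * c + r * (1 - 3 * r) * c ^+ 2) *: beta &
      (exists j, (j < q)%N /\ mt =L2 nt j *: gam j) ->
        exists c : R, 0 < c /\
          forall j, (j < q)%N -> nt j != 0 -> nt j ^+ 2 = c].
Proof.
move=> nt mt beta K4 r.
have gam_on := gam_basis.1.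
have K_sa : self_adjoint K by have [_ []] := K_cov.
have kE := kappaE alpha X_gauss gam_on gam_eigen lam_gt0.
pose b j := nt j / Num.sqrt (lam j).
have sl0 j : 0 < Num.sqrt (lam j) by rewrite sqrtr_gt0.
have bE : beta =L2 lincomb gam q b by exact: beta_qE.
have mtE : mt =L2 lincomb gam q nt by exact: mDeltat_qE.
have K4E : K4 beta = lincomb gam q (fun j => kappa P X m gam lam alpha j * b j).
  exact: K4q_lincomb.
have nuE j : nu m gam j = nt j * Num.sqrt (lam j).
  by rewrite /nt /nut divfK// gt_eqF.
(* This index supplies the constant [c = nt k ^+ 2] below and shows that [beta] is nonzero. *)
have [k kq ntk] : exists2 k, (k < q)%N & nt k != 0.
  apply: contrapT => nex; apply: mDelta_q_neq0; rewrite mDelta_qE.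
  rewrite (eq_lincomb gam (y := fun=> 0)) ?lincomb0; first exact: eqL2_refl.
  move=> j jq; rewrite nuE; have [->|nj] := eqVneq (nt j) 0; first by rewrite mul0r.
  by case: nex; exists j.
have ntk0 : 0 < nt k ^+ 2 by rewrite exprn_even_gt0.
have b0 j : (b j == 0) = (nt j == 0).
  by rewrite /b mulf_eq0 invr_eq0 (gt_eqF (sl0 j)) orbF.
have r0 : 0 < r by rewrite mulr_gt0 // subr_gt0.
(* [r = 1 / 4 - (alpha - 1 / 2) ^+ 2], so [3 * r <= 3 / 4]. *)
have r3 : 3 * r < 1 by rewrite /r /rho; have := sqr_ge0 (alpha - 1 / 2); nra.
have K4_eigen c : (forall j, (j < q)%N -> nt j != 0 -> nt j ^+ 2 = c) ->
    K4 beta =L2 (3 + 2 * r * c + r * (1 - 3 * r) * c ^+ 2) *: beta.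
  move=> hc; apply: eqL2_trans (eqL2Z _ (eqL2_sym bE)); rewrite K4E scale_lincomb.
  rewrite (eq_lincomb gam (y := fun j => (3 + 2 * r * c + r * (1 - 3 * r) * c ^+ 2) * b j)).
    exact: eqL2_refl.
  (* Off the support of [beta] both coordinates vanish; on it [nt j ^+ 2 = c] turns [kappa j] into
     the claimed eigenvalue. *)
  move=> j jq; have [bj|] := eqVneq (b j) 0; first by rewrite bj !mulr0.
  by rewrite b0 => /(hc _ jq) <-; rewrite kE.
split.
- by apply: eqL2_trans bE _; apply: eqL2_sym; exact: Kq_pinv_half_lincomb.
- split=> [[_ [a Ka]]|[c [c0 hc]]].
    (* Comparing coordinates and cancelling [b j] makes [kappa] constant on the support; injectivity
       of the polynomial then passes this on to [nt j ^+ 2]. *)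
    have kb j : (j < q)%N -> nt j != 0 -> kappa P X m gam lam alpha j = a.
      move=> jq; rewrite -b0 => bj; apply: (mulIf bj).
      have := eqL2_trans Ka (eqL2Z a bE); rewrite K4E scale_lincomb.
      by move=> /(lincomb_inj gam_on)/(_ j jq).
    exists (nt k ^+ 2); split=> // j jq ntj.
    apply: (@kappa_poly_inj _ r) => //; rewrite ?sqr_ge0//.
    by rewrite -!kE !kb.
  split; last by eexists; exact: K4_eigen hc.
  move=> beta0; have : lincomb gam q b =L2 lincomb gam q (fun=> 0).
    by rewrite lincomb0; exact: eqL2_trans (eqL2_sym bE) beta0.
  by move=> /(lincomb_inj gam_on)/(_ k kq)/eqP; rewrite b0 (negbTE ntk).
- by move=> c _; exact: K4_eigen.
- move=> [j [jq mtj]]; exists (nt k ^+ 2); split=> // i iq nti.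
  (* By orthonormality every coordinate of [mt] other than the [j]-th is 0, so both [i] and [k] must
     equal [j]. *)
  have sup l : (l < q)%N -> nt l != 0 -> l = j.
    move=> lq ntl; apply/eqP; apply: contraNT ntl => lj; apply/eqP.
    rewrite -(inner_lincomb gam_on nt lq) -(eqL2_innerl _ mtE) (eqL2_innerl _ mtj).
    by rewrite innerZl gam_on eq_sym (negbTE lj) mulr0.
  by rewrite (sup i)// (sup k).
Qed.
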